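(* Let $\vartheta>0$ and $\alpha>0$. Consider the sequence $(\theta_{0,n})_{n\ge1}$ in $\mathscr{K}_s([0,\vartheta])$ described by $$\theta_{0,n}(t)=\sum_{k=0}^{n}\mathrm{C}^k_n\,\psi_0\!\left(\frac{k}{n}\right)e^{-\alpha kt}(1-e^{-\alpha t})^{n-k},\qquad t\in[0,\vartheta],$$ and $0$ elsewhere. Then $\theta_{0,n}$ uniformly converges to $\theta_0$ for the $\mathscr{A}$-norm; that is, for every $\varepsilon>0$ there exists $n\in\mathbb{N}$ such that $\|\theta_0-\theta_{0,\kappa}\|_{\mathscr{A}}\le\varepsilon$ for all $\kappa\ge n$.
   Context: $\theta_0(t)=1$ for $t\in[0,\vartheta]$ and $\theta_0(t)=0$ elsewhere. $\psi_0(\xi)=\theta_0(-\alpha^{-1}\ln\xi)$ for $\xi\in(0,1]$, and $\psi_0(0)=0$. $\mathrm{C}^k_n=\frac{n!}{k!(n-k)!}$. $\mathscr{K}_s([0,\vartheta])$ is the set of functions that vanish outside $[0,\vartheta]$ and equal on $[0,\vartheta]$ a finite sum $\sum_{i,j\geq 0}c_{ij}t^je^{\lambda_i t}$ with $c_{ij},\lambda_i\in\mathbb{C}$ and $\mathrm{Re}\,\lambda_i<0$ for all $i$. For $f\in\mathscr{L}_1(\mathbb{R}_+)$, $\|f\|_{\mathscr{A}}=\|f\|_{\mathscr{L}_1}=\int_0^\infty|f(t)|\,dt$. In the paper's terminology, a sequence $f_n$ ''uniformly converges'' to $f$ if for every $\varepsilon>0$ there is $n$ such that $\|f-f_\kappa\|_{\mathscr{A}}\le\varepsilon$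 for all $\kappa\ge n$. *)

(* Defs.v *)
From HB Require Import structures.
From mathcomp Require Import all_boot all_order all_algebra.
From mathcomp Require Import complex.
From mathcomp Require Import all_classical all_reals all_analysis.
Import Order.TTheory GRing.Theory Num.Theory.

Set Implicit Arguments.
Unset Strict Implicit.
Unset Printing Implicit Defensive.

Local Open Scope classical_set_scope.
Local Open Scope complex_scope.
Local Open Scope ring_scope.

(* e^z = e^(Re z) (cos (Im z) + i sin (Im z)). *)
Definition cexp (R : realType) (z : R[i]) : R[i] :=
  (expR (complex.Re z))%:C *
  (cos (complex.Im z) +i* sin (complex.Im z)).

Definition toC (R : realType) (f : R -> R) : R -> R[i] := fun t => (f t)%:C.

(* The finite double sum is indexed by i < p and j < q. *)
Definition Ks (R : realType) (vartheta : R) : set (R -> R[i]) :=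
  [set f | (forall t, t \notin `[0, vartheta] -> f t = 0) /\
    exists (p q : nat) (c : 'I_p -> 'I_q -> R[i]) (lambda : 'I_p -> R[i]),
      (forall i, complex.Re (lambda i) < 0) /\
      forall t, t \in `[0, vartheta] ->
        f t = \sum_(i < p) \sum_(j < q)
                c i j * t%:C ^+ j * cexp (lambda i * t%:C)].

(* ComplexField.Normc.normc is the R-valued modulus; the canonical norm `|z|
   on R[i] takes its values in R[i]. *)
Definition normA (R : realType) (f : R -> R[i]) : \bar R :=
  (\int[lebesgue_measure]_(t in `[0%R, +oo[) (ComplexField.Normc.normc (f t))%:E)%E.

Definition uniformly_converges (R : realType)
    (f_ : nat -> R -> R[i]) (f : R -> R[i]) : Prop :=
  forall eps : R, 0 < eps ->
    exists n : nat, (1 <= n)%N /\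
      forall kappa : nat, (n <= kappa)%N ->
        (normA (fun t => (f t - f_ kappa t)%R) <= eps%:E)%E.

Definition theta0 (R : realType) (vartheta : R) (t : R) : R :=
  if t \in `[0, vartheta] then 1 else 0.

(* Only the values on [0, 1] are meaningful. *)
Definition psi0 (R : realType) (alpha vartheta : R) (xi : R) : R :=
  if xi \in `]0, 1] then theta0 vartheta (- alpha^-1 * ln xi) else 0.

Definition theta0n (R : realType) (alpha vartheta : R) (n : nat) (t : R) : R :=
  if t \in `[0, vartheta] then
    \sum_(k < n.+1) 'C(n, k)%:R * psi0 alpha vartheta (k%:R / n%:R)
      * expR (- (alpha * k%:R * t)) * (1 - expR (- (alpha * t))) ^+ (n - k)
  else 0.

(* Main.v *)
(* On [0, vartheta], theta0n is the Bernstein polynomial of psi0 evaluated at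
   x = e^(- alpha t). Its constant coefficient is psi0 0 = 0, so only decaying
   exponentials occur. Since psi0 = 1 on [a, 1] with a = e^(- alpha vartheta),
   the error at t is at most the probability that a binomial (n, x) variable is
   below n a. Chebyshev's inequality makes it O(1 / n) uniformly for t away from
   vartheta, and the remaining interval [vartheta - d, vartheta] contributes at
   most d to the integral because the error never exceeds 1. *)
Require Import Defs.
From mathcomp Require Import all_boot all_order all_algebra.
From mathcomp Require Import complex.
From mathcomp Require Import all_classical all_reals all_analysis.
From mathcomp Require Import measurable_realfun ring lra.
Import Order.TTheory GRing.Theory Num.Theory.
Import numFieldNormedType.Exports.
Local Open Scope ring_scope.

(** * Bernstein polynomials and Chebyshev's inequality *)

(** Kept as a formal polynomial, since membership in [Ks] needs its coefficients; [f k] is the value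
    at the [k]-th node, so no division by [n] enters. *)
Definition bernstein (R : comNzRingType) (n : nat) (f : nat -> R) : {poly R} :=
  \sum_(k < n.+1) ('C(n, k)%:R * f k) *: ('X^k * (1 - 'X) ^+ (n - k)).

Lemma horner_bernstein (R : comNzRingType) n (f : nat -> R) x :
  (bernstein R n f).[x] =
  \sum_(k < n.+1) 'C(n, k)%:R * f k * x ^+ k * (1 - x) ^+ (n - k).
Proof.
rewrite /bernstein horner_sum; apply: eq_bigr => k _.
by rewrite !hornerE.
Qed.

(** Pascal's rule, or conditioning a binomial variable on one trial: a success, of probability [x],
    shifts [f] by one. *)
Lemma bernsteinS (R : comNzRingType) n (f : nat -> R) x :
  (bernstein R n.+1 f).[x] =
  x * (bernstein R n (f \o succn)).[x] + (1 - x) * (bernstein R n f).[x].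
Proof.
rewrite !horner_bernstein big_ord_recl [X in _ + (1 - x) * X]big_ord_recl /=.
rewrite !bin0 !subn0 expr0 exprS !mul1r mulr1.
have -> : \sum_(i < n) 'C(n, bump 0 i)%:R * f (bump 0 i) * x ^+ bump 0 i *
    (1 - x) ^+ (n - bump 0 i) =
  \sum_(i < n.+1) 'C(n, i.+1)%:R * f i.+1 * x ^+ i.+1 * (1 - x) ^+ (n - i.+1).
  by rewrite big_ord_recr /= bin_small// !mul0r addr0.
rewrite mulrDr addrCA; congr (_ + _); first by rewrite mulrCA.
rewrite !mulr_sumr -big_split; apply: eq_bigr => i _ /=.
rewrite /bump /= !add1n subSS binS natrD exprS.
(* For [i < n] one factor [1 - x] splits off from the power [n - i]. At [i = n] truncated
   subtraction forbids this, but there ['C(n, n.+1)] is 0. *)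
case: (ltngtP i n) (ltn_ord i) => [lt_in _||eq_in _]; last first.
- by rewrite eq_in bin_small// binn !mul0r mulr0 add0r addr0; ring.
- by move=> h; rewrite ltnS leqNgt h.
by rewrite -(subnSK lt_in) exprS; ring.
Qed.

Lemma bernstein1 (R : comNzRingType) n (x : R) :
  (bernstein R n (fun=> 1)).[x] = 1.
Proof.
elim: n => [|n IHn]; last by rewrite bernsteinS IHn !mulr1 addrC subrK.
by rewrite horner_bernstein big_ord1 bin0 !expr0 !mulr1.
Qed.

(* The free centre [c] makes the induction on [n] go through. *)
Lemma bernstein_sqr (R : comNzRingType) n (x c : R) :
  (bernstein R n (fun k => (k%:R - c) ^+ 2)).[x] =
  n%:R * x * (1 - x) + (n%:R * x - c) ^+ 2.
Proof.
elim: n c => [|n IHn] c.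
  by rewrite horner_bernstein big_ord1 bin0 !expr0 /=; ring.
rewrite bernsteinS IHn.
have -> : (bernstein R n ((fun k => (k%:R - c) ^+ 2) \o succn)).[x] =
    (bernstein R n (fun k => (k%:R - (c - 1)) ^+ 2)).[x].
  rewrite !horner_bernstein; apply: eq_bigr => k _ /=.
  by congr (_ * _ ^+ 2 * _ * _); rewrite -natr1; ring.
by rewrite IHn -natr1; ring.
Qed.

Lemma bernsteinB (R : comNzRingType) n (f g : nat -> R) x :
  (bernstein R n (fun k => f k - g k)).[x] =
  (bernstein R n f).[x] - (bernstein R n g).[x].
Proof.
rewrite !horner_bernstein -sumrB; apply: eq_bigr => k _.
by rewrite mulrBr !mulrBl.
Qed.

Lemma bernsteinZ (R : comNzRingType) n (c : R) (f : nat -> R) x :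
  (bernstein R n (fun k => c * f k)).[x] = c * (bernstein R n f).[x].
Proof.
rewrite !horner_bernstein mulr_sumr; apply: eq_bigr => k _.
by rewrite mulrCA !mulrA.
Qed.

(** At [x = 0] only the term [k = 0] survives. *)
Lemma bernstein_coef0 (R : comNzRingType) n (f : nat -> R) :
  (bernstein R n f)`_0 = f 0%N.
Proof.
rewrite -horner_coef0 horner_bernstein big_ord_recl /= big1 ?addr0.
  by rewrite bin0 !expr0 subr0 expr1n mul1r !mulr1.
by move=> i _; rewrite expr0n mulr0 mul0r.
Qed.

Lemma ler_bernstein (R : numDomainType) n (f g : nat -> R) x :
  0 <= x <= 1 -> (forall k, (k <= n)%N -> f k <= g k) ->
  (bernstein R n f).[x] <= (bernstein R n g).[x].
Proof.
move=> /andP[x0 x1] fg; rewrite !horner_bernstein; apply: ler_sum => k _.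
rewrite ler_wpM2r ?exprn_ge0 ?subr_ge0//.
by rewrite ler_wpM2r ?exprn_ge0// ler_wpM2l// fg// -ltnS.
Qed.

(** For every [k <= n], [1 - g k] is at most [((k - n x) / (n d))^2]; averaging against the binomial
    weights turns the right side into a variance. *)
Lemma bernstein_chebyshev (R : realFieldType) n (g : nat -> R) (a d x : R) :
  (0 < n)%N -> 0 < d -> a + d <= x -> 0 <= x <= 1 ->
  (forall k, 0 <= g k <= 1) ->
  (forall k, (k <= n)%N -> a <= k%:R / n%:R -> g k = 1) ->
  1 - (bernstein R n g).[x] <= (n%:R * d ^+ 2)^-1.
Proof.
move=> n0 d0 adx /andP[x0 x1] g01 ga.
have n0' : 0 < n%:R :> R by rewrite ltr0n.
have nd0 : 0 < (n%:R * d) ^+ 2 by rewrite exprn_gt0// mulr_gt0.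
rewrite -[X in X - _](bernstein1 _ n x) -bernsteinB.
apply: (@le_trans _ _ (bernstein R n
    (fun k => ((n%:R * d) ^+ 2)^-1 * (k%:R - n%:R * x) ^+ 2)).[x]).
  apply: ler_bernstein; first by rewrite x0.
  move=> k kn; have /andP[g0 g1] := g01 k.
  have [ak|ka] := lerP a (k%:R / n%:R).
    by rewrite ga// subrr mulr_ge0 ?invr_ge0 ?sqr_ge0// ltW.
  (* Here [k < n a <= n x - n d], so the deviation [n x - k] is at least [n d], while
     [1 - g k <= 1]. *)
  rewrite mulrC ler_pdivlMr//.
  move: ka; rewrite ltr_pdivrMr// => ka.
  apply: (@le_trans _ _ ((n%:R * d) ^+ 2)).
    by rewrite ler_piMl ?sqr_ge0//; lra.
  have : n%:R * (a + d) <= n%:R * x by rewrite ler_pM2l.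
  have nd0' : 0 <= n%:R * d by rewrite mulr_ge0 ?ltW.
  rewrite mulrDr [n%:R * a]mulrC => nadx.
  have ndx : n%:R * d <= - (k%:R - n%:R * x) by lra.
  by rewrite -[leRHS]sqrrN lerXn2r ?nnegrE// (le_trans nd0').
(* With centre [n x] the bias vanishes and the variance [n x (1 - x)] remains, bounded crudely by
   [n]. *)
rewrite bernsteinZ bernstein_sqr subrr expr0n addr0.
have -> : (n%:R * d ^+ 2)^-1 = ((n%:R * d) ^+ 2)^-1 * n%:R.
  by field; rewrite !gt_eqF.
rewrite ler_pM2l ?invr_gt0// -[leRHS]mulr1 -mulrA ler_pM2l//.
by nra.
Qed.

(** * The approximants as Bernstein polynomials in e^(-alpha t) *)

Section theta.
Context (R : realType) (vartheta alpha : R).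
Hypothesis alpha_gt0 : 0 < alpha.

Let P n := bernstein R n (fun k => psi0 alpha vartheta (k%:R / n%:R)).

Lemma psi0_bounds xi : 0 <= psi0 alpha vartheta xi <= 1.
Proof. by rewrite /psi0 /theta0; case: ifP => _; [case: ifP => _|]; rewrite ?lexx ?ler01. Qed.

Lemma psi0_eq1 xi : expR (- (alpha * vartheta)) <= xi <= 1 ->
  psi0 alpha vartheta xi = 1.
Proof.
move=> /andP[axi xi1].
have xi0 : 0 < xi by rewrite (lt_le_trans _ axi)// expR_gt0.
rewrite /psi0 /theta0 !in_itv/= xi0 xi1 mulNr -mulrN.
rewrite mulr_ge0 ?invr_ge0 ?oppr_ge0 ?ln_le0 ?(ltW alpha_gt0)//=.
by rewrite mulrC ler_pdivrMr// lerNl mulrC -ler_expR lnK ?axi.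
Qed.

Lemma theta0nE n t : theta0n alpha vartheta n t =
  theta0 vartheta t * (P n).[expR (- (alpha * t))].
Proof.
rewrite /theta0n /theta0; case: ifP => _; last by rewrite mul0r.
rewrite mul1r horner_bernstein; apply: eq_bigr => k _.
by rewrite -expRM_natl mulrN mulrCA mulrA.
Qed.

Lemma theta0n_Ks n : Ks vartheta (toC (theta0n alpha vartheta n)).
Proof.
split=> [t|]; first by rewrite /toC /theta0n => /negbTE ->.
(* No power of [t] occurs, hence [q = 1]. The exponents start at [- alpha]: index [i] carries the
   coefficient of degree [i.+1]. *)
exists (size (P n)), 1%N, (fun i _ => ((P n)`_i.+1)%:C%C),
  (fun i => (- (alpha * i.+1%:R))%:C%C).
split=> [i /=|t t0]; first by rewrite oppr_lt0 mulr_gt0.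
rewrite /toC theta0nE /theta0 t0 mul1r.
(* The node [0 / n] is 0 even for [n = 0], where division by zero returns 0. *)
have P0 : (P n)`_0 = 0 by rewrite bernstein_coef0 mul0r /psi0 in_itv/= ltxx.
(* Padding with one zero top coefficient leaves exactly [size (P n)] terms once the constant one is
   removed. *)
rewrite (horner_coef_wide _ (leqnSn _)) big_ord_recl /= P0 mul0r add0r.
rewrite rmorph_sum; apply: eq_bigr => i _; rewrite big_ord1 expr0 mulr1.
rewrite /cexp /= !mulr0 !mul0r subr0 addr0 cos0 sin0 rmorphM /= mulr1.
congr (_ * _%:C%C).
by rewrite -expRM_natl /bump /= add1n; congr expR; ring.
Qed.

Lemma bernstein_psi0_bounds n x : 0 <= x <= 1 -> 0 <= (P n).[x] <= 1.
Proof.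
move=> x01; apply/andP; split; last first.
  rewrite -(bernstein1 _ n x); apply: ler_bernstein => // k _.
  by have /andP[] := psi0_bounds (k%:R / n%:R).
rewrite -(mul0r (bernstein R n (fun=> 1)).[x]) -bernsteinZ.
apply: ler_bernstein => // k _; rewrite mul0r.
by have /andP[] := psi0_bounds (k%:R / n%:R).
Qed.

Lemma measurable_theta0B n :
  measurable_fun setT (fun t => theta0 vartheta t - theta0n alpha vartheta n t).
Proof.
(* An indicator times a continuous function. *)
have -> : (fun t => theta0 vartheta t - theta0n alpha vartheta n t) =
    (\1_`[0, vartheta]%classic \* (fun t => 1 - (P n).[expR (- (alpha * t))])).
  apply/funext => t; rewrite theta0nE /= mulrBr mulr1 indicE mem_setE.
  by rewrite /theta0; case: ifP.
apply: measurable_funM; first exact: measurable_indic.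
apply: continuous_measurable_fun => t.
apply: cvgB; first exact: cvg_cst.
apply: (continuous_comp (f := fun t => expR (- (alpha * t))) (g := horner (P n))).
  apply: (continuous_comp (f := fun t => - (alpha * t)) (g := expR)).
    by apply: cvgN; apply: mulrl_continuous.
  exact: continuous_expR.
exact: continuous_horner.
Qed.

Lemma normA_toCB (f g : R -> R) :
  normA (fun t => toC f t - toC g t) =
  (\int[lebesgue_measure]_(t in `[0%R, +oo[) `|f t - g t|%:E)%E.
Proof.
rewrite /normA; apply: eq_integral => t _.
by rewrite /toC -rmorphB /= expr0n addr0 sqrtr_sqr.
Qed.

(** The margin [d] in [t] becomes a margin [e] in x = e^(-alpha t): Chebyshev's bound covers
    [t < vartheta - d], and the second indicator absorbs the rest. *)
Lemma theta0B_le n d e t : (0 < n)%N -> 0 < e ->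
  expR (- (alpha * vartheta)) + e <= expR (- (alpha * (vartheta - d))) ->
  `|theta0 vartheta t - theta0n alpha vartheta n t| <=
  (n%:R * e ^+ 2)^-1 * \1_`[0, vartheta]%classic t
    + \1_`[vartheta - d, vartheta]%classic t.
Proof.
move=> n0 e0 ade.
have b0 : 0 <= (n%:R * e ^+ 2)^-1 by rewrite invr_ge0 mulr_ge0// sqr_ge0.
rewrite theta0nE -[X in X - _]mulr1 -mulrBr !indicE !mem_setE /theta0.
case: ifPn => t0; last by rewrite mul0r normr0 addr_ge0 ?mulr_ge0.
have := t0; rewrite in_itv/= => /andP[t_ge0 t_le].
have x01 : 0 <= expR (- (alpha * t)) <= 1.
  by rewrite expR_ge0 -[leRHS]expR0 ler_expR oppr_le0 mulr_ge0// ltW.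
have /andP[P0 P1] := bernstein_psi0_bounds n _ x01.
rewrite mul1r mulr1 ger0_norm ?subr_ge0// in_itv/= t_le andbT.
have [dt|td] := leP (vartheta - d) t.
  by rewrite (@le_trans _ _ 1) ?lerDr// lerBlDr lerDl.
rewrite addr0.
have ade' : expR (- (alpha * vartheta)) + e <= expR (- (alpha * t)).
  by rewrite (le_trans ade)// ler_expR lerN2 ler_pM2l// ltW.
apply: (bernstein_chebyshev _ _ _ _ _ _ n0 e0 ade' x01) => // [k|k kn ak]; first exact: psi0_bounds.
by apply: psi0_eq1; rewrite ak ler_pdivrMr ?ltr0n// mul1r ler_nat.
Qed.

End theta.

(** * Integration of the pointwise bound *)

Theorem lemma4 (R : realType) (vartheta alpha : R)
    (vartheta_gt0 : 0 < vartheta) (alpha_gt0 : 0 < alpha) :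
  (forall n : nat, (1 <= n)%N ->
     Ks vartheta (toC (theta0n alpha vartheta n))) /\
  uniformly_converges
    (fun n => toC (theta0n alpha vartheta n)) (toC (theta0 vartheta)).
Proof.
split=> [n _|eps eps0]; first exact: theta0n_Ks.
(* Each error gets half of [eps]: [eta * vartheta] away from the jump and [d] next to it. *)
pose d := eps / 2; pose eta := eps / (2 * vartheta).
have d0 : 0 < d by rewrite divr_gt0.
have eta0 : 0 < eta by rewrite mulr_gt0 ?invr_gt0 ?mulr_gt0.
pose e := expR (- (alpha * (vartheta - d))) - expR (- (alpha * vartheta)).
have e0 : 0 < e.
  by rewrite subr_gt0 ltr_expR ltrN2 ltr_pM2l// ltrBlDr ltrDl.
(* The successor of the truncation exceeds [(eta * e ^+ 2)^-1], which forces [(n e^2)^-1 <= eta],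
   and is positive. *)
exists (Num.truncn (eta * e ^+ 2)^-1).+1; split=> // n ltn.
have n0 : (0 < n)%N by exact: leq_trans ltn.
have ne : (n%:R * e ^+ 2)^-1 <= eta.
  rewrite invf_ple ?posrE// ?mulr_gt0 ?exprn_gt0 ?ltr0n//.
  rewrite -ler_pdivrMr ?exprn_gt0// -invfM ltW//.
  by rewrite (lt_le_trans (truncnS_gt _))// ler_nat.
rewrite normA_toCB.
have mA (a b : R) : measurable (`[a, b]%classic : set R) by exact: measurable_itv.
have mI (a b : R) (D : set R) :
    measurable_fun D (fun t => (\1_`[a, b]%classic t)%:E : \bar R).
  by apply/measurable_EFinP; exact: measurable_indic.
apply: (@le_trans _ _ (\int[lebesgue_measure]_(t in `[0%R, +oo[)
   (eta%:E * (\1_`[0, vartheta]%classic t)%:E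
    + (\1_`[vartheta - d, vartheta]%classic t)%:E))%E).
  apply: ge0_le_integral => //=.
  - apply/measurable_EFinP/measurableT_comp => //.
    by apply: measurable_funTS; exact: measurable_theta0B.
  - apply: emeasurable_funD; [exact: measurable_funeM (mI _ _ _)|exact: mI].
  move=> t _; rewrite -EFinM -EFinD lee_fin.
  apply: (le_trans (@theta0B_le _ _ _ alpha_gt0 n d e t n0 e0 _)).
    by rewrite /e addrC subrK.
  by rewrite lerD2r ler_wpM2r.
rewrite ge0_integralD//=; last 3 first.
- by move=> t _; rewrite -EFinM lee_fin mulr_ge0// ltW.
- exact: measurable_funeM (mI _ _ _).
- exact: mI.
rewrite ge0_integralZl_EFin//=; [|exact: mI|exact: ltW].
rewrite !integral_indic//=.
apply: (@le_trans _ _ (eta%:E * vartheta%:E + d%:E)%E); last first.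
  rewrite -EFinM -EFinD lee_fin /eta /d.
  suff -> : eps / (2 * vartheta) * vartheta + eps / 2 = eps by [].
  by field; rewrite gt_eqF.
(* Only an upper bound holds in general: [vartheta - d] is negative for large [eps], and the
   half-line then cuts the interval. *)
have mle (a b : R) : a <= b ->
    (lebesgue_measure (`[a, b] `&` `[0%R, +oo[)%classic <= (b - a)%:E)%E.
  move=> ab; apply: (@le_trans _ _ (lebesgue_measure (`[a, b]%classic : set R))).
    by apply: le_measure; rewrite ?inE//; exact: measurableI.
  rewrite lebesgue_measure_itv/= lte_fin; case: ifPn => // _.
  by rewrite lee_fin subr_ge0.
apply: leeD.
  by rewrite lee_pmul2l// ?lte_fin// (le_trans (mle _ _ _)) ?subr0// ltW.
by rewrite (le_trans (mle _ _ _)) ?lee_fin; lra.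
Qed.
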